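(* Let $\mathcal{C}$ be a homological category with binary coproducts. Then $\mathcal{C}$ is algebraically coherent if and only if for every object $X$ of $\mathcal{C}$ the functor $X\flat(-)\colon\mathcal{C}\to\mathcal{C}$ preserves jointly strongly epimorphic pairs.
   Context: A pointed, regular and protomodular category is called homological. A category is protomodular if it has pullbacks of split epimorphisms along any map and all change-of-base functors between its categories of points (defined below) reflect isomorphisms. For objects $X,Y$ of a pointed category with binary coproducts and kernels, $X\flat Y$ is the kernel of the morphism $X+Y\to X$ which is $1_X$ on $X$ and $0$ on $Y$; this is functorial in $Y$, giving $X\flat(-)\colon\mathcal{C}\to\mathcal{C}$. A cospan $(f\colon X\to Z,\ g\colon Y\to Z)$ in a category with finite limits is jointly strongly epimorphic if every monomorphism into $Z$ through which both $f$ and $g$ factor is an isomorphism. A functor between categories with finite limits is coherent if it preserves finite limits and jointly strongly epimorphic pairs. $\mathsf{Pt}_X(\mathcal{C})$ is the category of points over $X$: objects are triples $(A,\ p\colon A\to X,\ s\colon X\to A)$ with $ps=1_X$, and morphisms are morphisms between the objects $A$ commuting with the $p$'s and the $s$'s. For $f\colon X\to Y$, the change-of-base functor $f^*\colon \mathsf{Pt}_Y(\mathcal{C})\to\mathsf{Pt}_X(\mathcal{C})$ is pulling back along $f$. A category $\mathcal{C}$ with finite limits is algebraically coherent if $f^*$ is coherent for every morphism $f$ of $\mathcal{C}$. *)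

(* Defs.v *)
From Stdlib Require Import List FinFun ProofIrrelevance ClassicalEpsilon.

Set Implicit Arguments.
Unset Strict Implicit.
Unset Printing Implicit Defensive.

(* Existence of limits and colimits is a proposition.  Whenever an operation
   such as [change_of_base] or [flat] needs a particular (co)limit, one is
   selected by [choose]; the selection is immaterial up to isomorphism. *)
Definition choose (T : Type) (h : inhabited T) : T :=
  proj1_sig (constructive_indefinite_description (fun _ : T => True)
    (match h with inhabits t => ex_intro _ t I end)).

Definition the (T : Type) (P : T -> Prop) (h : exists! x, P x) : T :=
  proj1_sig (constructive_definite_description P h).

Lemma the_spec (T : Type) (P : T -> Prop) (h : exists! x, P x) : P (the h).
Proof. exact (proj2_sig (constructive_definite_description P h)). Qed.

Lemma exists_unique_eq (T : Type) (P : T -> Prop) (x y : T) :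
  (exists! z, P z) -> P x -> P y -> x = y.
Proof.
  intros [z [_ Hz]] Hx Hy. rewrite <- (Hz x Hx). exact (Hz y Hy).
Qed.

Record Category : Type := {
  Ob :> Type;
  Hom : Ob -> Ob -> Type;
  id : forall X : Ob, Hom X X;
  comp : forall X Y Z : Ob, Hom Y Z -> Hom X Y -> Hom X Z;
  comp_id_l : forall (X Y : Ob) (f : Hom X Y), comp (id Y) f = f;
  comp_id_r : forall (X Y : Ob) (f : Hom X Y), comp f (id X) = f;
  comp_assoc : forall (X Y Z W : Ob)
      (h : Hom Z W) (g : Hom Y Z) (f : Hom X Y),
    comp h (comp g f) = comp (comp h g) f
}.

Arguments Hom {c} X Y.
Arguments id {c} X.
Arguments comp {c X Y Z} g f.

Declare Scope cat_scope.
Delimit Scope cat_scope with cat.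
Local Open Scope cat_scope.
Notation "g ∘ f" := (comp g f) (at level 40, left associativity) : cat_scope.

Record Functor (C D : Category) : Type := {
  fobj :> C -> D;
  fmap : forall X Y : C, Hom X Y -> Hom (fobj X) (fobj Y);
  fmap_id : forall X : C, fmap (id X) = id (fobj X);
  fmap_comp : forall (X Y Z : C) (g : Hom Y Z) (f : Hom X Y),
    fmap (g ∘ f) = fmap g ∘ fmap f
}.

Arguments fmap {C D} F {X Y} f : rename.

Definition mono (C : Category) (X Y : C) (m : Hom X Y) : Prop :=
  forall (T : C) (a b : Hom T X), m ∘ a = m ∘ b -> a = b.

Definition iso (C : Category) (X Y : C) (f : Hom X Y) : Prop :=
  exists g : Hom Y X, g ∘ f = id X /\ f ∘ g = id Y.

Definition split_epi (C : Category) (X Y : C) (p : Hom X Y) : Prop :=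
  exists s : Hom Y X, p ∘ s = id Y.

Definition jointly_strongly_epimorphic (C : Category) (X Y Z : C)
    (f : Hom X Z) (g : Hom Y Z) : Prop :=
  forall (M : C) (m : Hom M Z), mono m ->
    (exists f' : Hom X M, m ∘ f' = f) ->
    (exists g' : Hom Y M, m ∘ g' = g) ->
    iso m.

Definition reflects_isos (C D : Category) (F : Functor C D) : Prop :=
  forall (X Y : C) (f : Hom X Y), iso (fmap F f) -> iso f.

Definition preserves_jse_pairs (C D : Category) (F : Functor C D) : Prop :=
  forall (X Y Z : C) (f : Hom X Z) (g : Hom Y Z),
    jointly_strongly_epimorphic f g ->
    jointly_strongly_epimorphic (fmap F f) (fmap F g).

Definition finite_category (J : Category) : Prop :=
  Finite (Ob J) /\ forall i j : J, Finite (Hom i j).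

Record Cone (J C : Category) (D : Functor J C) : Type := {
  vertex : C;
  leg : forall j : J, Hom vertex (D j);
  leg_natural : forall (i j : J) (a : Hom i j), fmap D a ∘ leg i = leg j
}.

Definition is_limit (J C : Category) (D : Functor J C) (c : Cone D) : Prop :=
  forall c' : Cone D, exists! u : Hom (vertex c') (vertex c),
    forall j : J, leg c j ∘ u = leg c' j.

Definition has_finite_limits (C : Category) : Prop :=
  forall J : Category, finite_category J ->
  forall D : Functor J C, exists c : Cone D, is_limit c.

Definition functor_comp (B C D : Category) (G : Functor C D) (F : Functor B C) :
  Functor B D.
Proof.
  refine {| fobj := fun X => G (F X);
            fmap := fun X Y f => fmap G (fmap F f) |}.
  - intros X. now rewrite !fmap_id.
  - intros X Y Z g f. now rewrite !fmap_comp.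
Defined.

Definition map_cone (J C E : Category) (F : Functor C E) (D : Functor J C)
  (c : Cone D) : Cone (functor_comp F D).
Proof.
  refine {| vertex := F (vertex c);
            leg := fun j => fmap F (leg c j) : Hom _ (functor_comp F D j) |}.
  intros i j a. cbn. now rewrite <- fmap_comp, leg_natural.
Defined.

Definition preserves_finite_limits (C E : Category) (F : Functor C E) : Prop :=
  forall J : Category, finite_category J ->
  forall (D : Functor J C) (c : Cone D), is_limit c -> is_limit (map_cone F c).

Definition coherent (C D : Category) (F : Functor C D) : Prop :=
  preserves_finite_limits F /\ preserves_jse_pairs F.

Definition is_pullback (C : Category) (X Y Z P : C)
    (f : Hom X Z) (g : Hom Y Z) (p1 : Hom P X) (p2 : Hom P Y) : Prop :=
  f ∘ p1 = g ∘ p2 /\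
  forall (T : C) (t1 : Hom T X) (t2 : Hom T Y), f ∘ t1 = g ∘ t2 ->
    exists! u : Hom T P, p1 ∘ u = t1 /\ p2 ∘ u = t2.

Record Pullback (C : Category) (X Y Z : C) (f : Hom X Z) (g : Hom Y Z) : Type := {
  pb : C;
  pb1 : Hom pb X;
  pb2 : Hom pb Y;
  pb_is_pullback : is_pullback f g pb1 pb2
}.

Definition pb_lift (C : Category) (X Y Z : C) (f : Hom X Z) (g : Hom Y Z)
    (P : Pullback f g) (T : C) (t1 : Hom T X) (t2 : Hom T Y)
    (e : f ∘ t1 = g ∘ t2) : Hom T (pb P) :=
  the (proj2 (pb_is_pullback P) T t1 t2 e).

Lemma pb_lift1 (C : Category) (X Y Z : C) (f : Hom X Z) (g : Hom Y Z)
    (P : Pullback f g) (T : C) (t1 : Hom T X) (t2 : Hom T Y)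
    (e : f ∘ t1 = g ∘ t2) : pb1 P ∘ pb_lift P e = t1.
Proof. exact (proj1 (the_spec (proj2 (pb_is_pullback P) T t1 t2 e))). Qed.

Lemma pb_lift2 (C : Category) (X Y Z : C) (f : Hom X Z) (g : Hom Y Z)
    (P : Pullback f g) (T : C) (t1 : Hom T X) (t2 : Hom T Y)
    (e : f ∘ t1 = g ∘ t2) : pb2 P ∘ pb_lift P e = t2.
Proof. exact (proj2 (the_spec (proj2 (pb_is_pullback P) T t1 t2 e))). Qed.

Lemma pb_ext (C : Category) (X Y Z : C) (f : Hom X Z) (g : Hom Y Z)
    (P : Pullback f g) (T : C) (u v : Hom T (pb P)) :
  pb1 P ∘ u = pb1 P ∘ v -> pb2 P ∘ u = pb2 P ∘ v -> u = v.
Proof.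
  intros e1 e2.
  assert (e : f ∘ (pb1 P ∘ v) = g ∘ (pb2 P ∘ v)).
  { rewrite !comp_assoc. now rewrite (proj1 (pb_is_pullback P)). }
  exact (exists_unique_eq (proj2 (pb_is_pullback P) T _ _ e)
           (conj e1 e2) (conj eq_refl eq_refl)).
Qed.

(* The category 1 -> * <- 2 indexing cospans; [None] is the codomain. *)
Definition cospan_hom (i j : option bool) : Type :=
  match i, j with
  | _, None => unit
  | None, Some _ => Empty_set
  | Some a, Some b => if Bool.eqb a b then unit else Empty_set
  end.

Definition cospan_category : Category.
Proof.
  unshelve refine {| Ob := option bool; Hom := cospan_hom |}.
  - intros [[|]|]; exact tt.
  - intros [[|]|] [[|]|] [[|]|] g f; cbn in *; solve [exact tt | destruct f | destruct g].
  - intros [[|]|] [[|]|] f; cbn in *; now destruct f.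
  - intros [[|]|] [[|]|] f; cbn in *; now destruct f.
  - intros [[|]|] [[|]|] [[|]|] [[|]|] h g f; cbn in *;
      now destruct h, g, f.
Defined.

Lemma cospan_category_finite : finite_category cospan_category.
Proof.
  split.
  - exists (None :: Some true :: Some false :: nil).
    intros [[|]|]; cbn; tauto.
  - intros [[|]|] [[|]|]; cbn;
      solve [exists (tt :: nil); intros []; cbn; tauto | exists nil; intros []].
Qed.

Definition cospan_diagram (C : Category) (X Y Z : C)
  (f : Hom X Z) (g : Hom Y Z) : Functor cospan_category C.
Proof.
  unshelve refine {| fobj := fun i : cospan_category =>
    match i with None => Z | Some true => X | Some false => Y end |}.
  - intros [[|]|] [[|]|] a; cbn in a |- *;
      solve [exact (id _) | exact f | exact g | destruct a].
  - intros [[|]|]; reflexivity.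
  - intros [[|]|] [[|]|] [[|]|] b a; cbn in *;
      solve [destruct a | destruct b | now rewrite ?comp_id_l, ?comp_id_r].
Defined.

Lemma finite_limits_pullbacks (C : Category) (hC : has_finite_limits C)
    (X Y Z : C) (f : Hom X Z) (g : Hom Y Z) : inhabited (Pullback f g).
Proof.
  destruct (hC _ cospan_category_finite (cospan_diagram f g)) as [c hc].
  pose (D := cospan_diagram f g).
  assert (sq : f ∘ leg c (Some true) = g ∘ leg c (Some false)).
  { pose proof (leg_natural c (i := Some true) (j := None) tt) as e1.
    pose proof (leg_natural c (i := Some false) (j := None) tt) as e2.
    exact (eq_trans e1 (eq_sym e2)). }
  apply inhabits. refine (Build_Pullback (pb := vertex c)
    (pb1 := leg c (Some true)) (pb2 := leg c (Some false)) _).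
  split; [exact sq|]. intros T t1 t2 e.
  unshelve epose (c' := Build_Cone (D := D) (vertex := T)
    (leg := fun j : cospan_category => match j return Hom T (D j) with
       | None => f ∘ t1 | Some true => t1 | Some false => t2 end) _).
  { intros [[|]|] [[|]|] a; cbn in *;
      solve [destruct a | now rewrite comp_id_l | now symmetry | reflexivity]. }
  destruct (hc c') as [u [Hu Huniq]]. exists u. split.
  - split; [exact (Hu (Some true)) | exact (Hu (Some false))].
  - intros v [v1 v2]. apply Huniq. intros [[|]|].
    + exact v1.
    + exact v2.
    + rewrite <- (leg_natural c (i := Some true) (j := None) tt).
      cbn. rewrite <- comp_assoc. now rewrite <- v1.
Qed.

Record Point (C : Category) (X : C) : Type := {
  pt_ob : C;
  pt_proj : Hom pt_ob X;
  pt_sect : Hom X pt_ob;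
  pt_split : pt_proj ∘ pt_sect = id X
}.

Definition PointHom (C : Category) (X : C) (A B : Point X) : Type :=
  {h : Hom (pt_ob A) (pt_ob B) |
    pt_proj B ∘ h = pt_proj A /\ h ∘ pt_sect A = pt_sect B}.

Lemma PointHom_eq (C : Category) (X : C) (A B : Point X) (h k : PointHom A B) :
  proj1_sig h = proj1_sig k -> h = k.
Proof. destruct h as [h ?], k as [k ?]. cbn. apply subset_eq_compat. Qed.

Definition PointId (C : Category) (X : C) (A : Point X) : PointHom A A.
Proof.
  exists (id (pt_ob A)). split; [apply comp_id_r | apply comp_id_l].
Defined.

Definition PointComp (C : Category) (X : C) (A B D : Point X)
  (k : PointHom B D) (h : PointHom A B) : PointHom A D.
Proof.
  exists (proj1_sig k ∘ proj1_sig h).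
  destruct k as [k [k1 k2]], h as [h [h1 h2]]. cbn. split.
  - now rewrite comp_assoc, k1.
  - now rewrite <- comp_assoc, h2.
Defined.

Definition Pt (C : Category) (X : C) : Category.
Proof.
  refine {| Ob := Point X; Hom := @PointHom C X;
            id := @PointId C X; comp := @PointComp C X |}.
  - intros A B h. apply PointHom_eq, comp_id_l.
  - intros A B h. apply PointHom_eq, comp_id_r.
  - intros A B D E l k h. apply PointHom_eq, comp_assoc.
Defined.

Definition has_pullbacks_of_split_epis (C : Category) : Prop :=
  forall (X Y A : C) (f : Hom X Y) (p : Hom A Y), split_epi p ->
    inhabited (Pullback f p).

Lemma finite_limits_split_pullbacks (C : Category) :
  has_finite_limits C -> has_pullbacks_of_split_epis C.
Proof. intros hC X Y A f p _. now apply finite_limits_pullbacks. Qed.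

Section ChangeOfBase.
Context (C : Category) (hC : has_pullbacks_of_split_epis C).
Context (X Y : C) (f : Hom X Y).

Definition pt_pullback (A : Point Y) : Pullback f (pt_proj A) :=
  choose (hC f (ex_intro _ (pt_sect A) (pt_split A))).

Lemma base_sect_eq (A : Point Y) :
  f ∘ id X = pt_proj A ∘ (pt_sect A ∘ f).
Proof. now rewrite comp_assoc, pt_split, comp_id_l, comp_id_r. Qed.

Definition base_ob (A : Point Y) : Point X := {|
  pt_ob := pb (pt_pullback A);
  pt_proj := pb1 (pt_pullback A);
  pt_sect := pb_lift (pt_pullback A) (base_sect_eq A);
  pt_split := pb_lift1 (pt_pullback A) (base_sect_eq A)
|}.

Lemma base_map_eq (A B : Point Y) (h : PointHom A B) :
  f ∘ pb1 (pt_pullback A) = pt_proj B ∘ (proj1_sig h ∘ pb2 (pt_pullback A)).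
Proof.
  rewrite comp_assoc, (proj1 (proj2_sig h)).
  exact (proj1 (pb_is_pullback (pt_pullback A))).
Qed.

Definition base_map (A B : Point Y) (h : PointHom A B) :
  PointHom (base_ob A) (base_ob B).
Proof.
  exists (pb_lift (pt_pullback B) (base_map_eq h)). cbn. split.
  - apply pb_lift1.
  - apply pb_ext; rewrite comp_assoc, ?pb_lift1, ?pb_lift2.
    + reflexivity.
    + rewrite <- comp_assoc, pb_lift2, comp_assoc.
      now rewrite (proj2 (proj2_sig h)).
Defined.

Definition change_of_base : Functor (Pt Y) (Pt X).
Proof.
  refine {| fobj := base_ob : Pt Y -> Pt X; fmap := base_map |}.
  - intros A. apply PointHom_eq. cbn. apply pb_ext.
    + now rewrite pb_lift1, comp_id_r.
    + rewrite pb_lift2, comp_id_r. apply comp_id_l.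
  - intros A B D k h. apply PointHom_eq. cbn. apply pb_ext.
    + now rewrite comp_assoc, !pb_lift1.
    + rewrite pb_lift2, comp_assoc, pb_lift2.
      rewrite <- (comp_assoc _ _ (pb_lift _ (base_map_eq h))), pb_lift2.
      symmetry. apply comp_assoc.
Defined.

End ChangeOfBase.

Arguments change_of_base {C} hC {X Y} f.

Definition algebraically_coherent (C : Category) : Prop :=
  exists hC : has_finite_limits C, forall (X Y : C) (f : Hom X Y),
    coherent (change_of_base (finite_limits_split_pullbacks hC) f).

Definition protomodular (C : Category) : Prop :=
  exists hC : has_pullbacks_of_split_epis C, forall (X Y : C) (f : Hom X Y),
    reflects_isos (change_of_base hC f).

Definition is_coequalizer (C : Category) (R A Q : C)
    (f g : Hom R A) (q : Hom A Q) : Prop :=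
  q ∘ f = q ∘ g /\
  forall (T : C) (t : Hom A T), t ∘ f = t ∘ g -> exists! u : Hom Q T, u ∘ q = t.

Definition regular_epi (C : Category) (A Q : C) (q : Hom A Q) : Prop :=
  exists (R : C) (f g : Hom R A), is_coequalizer f g q.

Definition regular (C : Category) : Prop :=
  has_finite_limits C /\
  (forall (R A B : C) (f : Hom A B) (r1 r2 : Hom R A), is_pullback f f r1 r2 ->
    exists (Q : C) (q : Hom A Q), is_coequalizer r1 r2 q) /\
  (forall (X Y Z P : C) (f : Hom X Z) (g : Hom Y Z) (p1 : Hom P X) (p2 : Hom P Y),
    is_pullback f g p1 p2 -> regular_epi g -> regular_epi p1).

Definition is_zero_object (C : Category) (O : C) : Prop :=
  forall X : C, (exists! f : Hom O X, True) /\ (exists! f : Hom X O, True).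

Definition pointed (C : Category) : Prop :=
  exists O : C, is_zero_object O.

Definition is_zero_map (C : Category) (X Y : C) (f : Hom X Y) : Prop :=
  exists O : C, is_zero_object O /\
    exists (a : Hom X O) (b : Hom O Y), f = b ∘ a.

Lemma zero_map_unique (C : Category) (X Y : C) (f g : Hom X Y) :
  is_zero_map f -> is_zero_map g -> f = g.
Proof.
  intros [O [hO [a [b ->]]]] [O' [hO' [a' [b' ->]]]].
  destruct (proj1 (hO O')) as [i _].
  rewrite (exists_unique_eq (proj1 (hO Y)) I I : b = b' ∘ i).
  rewrite (exists_unique_eq (proj2 (hO' X)) I I : a' = i ∘ a).
  now rewrite comp_assoc.
Qed.

Lemma zero_map_exists (C : Category) (hC : pointed C) (X Y : C) :
  exists! f : Hom X Y, is_zero_map f.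
Proof.
  destruct hC as [O hO].
  destruct (proj2 (hO X)) as [a _], (proj1 (hO Y)) as [b _].
  exists (b ∘ a). split.
  - exists O. split; [exact hO|]. now exists a, b.
  - intros g hg. apply zero_map_unique; [|exact hg].
    exists O. split; [exact hO|]. now exists a, b.
Qed.

Definition zero_map (C : Category) (hC : pointed C) (X Y : C) : Hom X Y :=
  the (zero_map_exists hC X Y).

Lemma zero_map_comp (C : Category) (hC : pointed C) (X Y Z : C) (f : Hom X Y) :
  zero_map hC Y Z ∘ f = zero_map hC X Z.
Proof.
  apply zero_map_unique; [|exact (the_spec (zero_map_exists hC X Z))].
  destruct (the_spec (zero_map_exists hC Y Z)) as [O [hO [a [b e]]]].
  exists O. split; [exact hO|]. exists (a ∘ f), b.
  unfold zero_map. now rewrite e, comp_assoc.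
Qed.

Definition is_kernel (C : Category) (hC : pointed C) (K X Y : C)
    (f : Hom X Y) (k : Hom K X) : Prop :=
  f ∘ k = zero_map hC K Y /\
  forall (T : C) (t : Hom T X), f ∘ t = zero_map hC T Y ->
    exists! u : Hom T K, k ∘ u = t.

Record Kernel (C : Category) (hC : pointed C) (X Y : C) (f : Hom X Y) : Type := {
  ker : C;
  ker_map : Hom ker X;
  ker_is_kernel : is_kernel hC f ker_map
}.

Definition has_kernels (C : Category) (hC : pointed C) : Prop :=
  forall (X Y : C) (f : Hom X Y), inhabited (Kernel hC f).

Lemma finite_limits_kernels (C : Category) (hC : pointed C) :
  has_finite_limits C -> has_kernels hC.
Proof.
  intros hlim X Y f. pose proof hC as [O hO].
  destruct (proj1 (hO Y)) as [o _].
  assert (z : forall (T : C) (a : Hom T O), o ∘ a = zero_map hC T Y).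
  { intros T a. apply zero_map_unique; [|exact (the_spec (zero_map_exists hC T Y))].
    exists O. split; [exact hO|]. now exists a, o. }
  destruct (finite_limits_pullbacks hlim f o) as [P].
  apply inhabits. refine (@Build_Kernel C hC X Y f (pb P) (pb1 P) _). split.
  - rewrite (proj1 (pb_is_pullback P)). apply z.
  - intros T t e. destruct (proj2 (hO T)) as [a _].
    assert (e' : f ∘ t = o ∘ a) by now rewrite z.
    exists (pb_lift P e'). split; [apply pb_lift1|].
    intros v hv. apply pb_ext.
    + now rewrite pb_lift1.
    + exact (exists_unique_eq (proj2 (hO T)) I I).
Qed.

Definition ker_lift (C : Category) (hC : pointed C) (X Y : C) (f : Hom X Y)
    (K : Kernel hC f) (T : C) (t : Hom T X) (e : f ∘ t = zero_map hC T Y) :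
    Hom T (ker K) :=
  the (proj2 (ker_is_kernel K) T t e).

Lemma ker_lift_eq (C : Category) (hC : pointed C) (X Y : C) (f : Hom X Y)
    (K : Kernel hC f) (T : C) (t : Hom T X) (e : f ∘ t = zero_map hC T Y) :
  ker_map K ∘ ker_lift K e = t.
Proof. exact (the_spec (proj2 (ker_is_kernel K) T t e)). Qed.

Lemma ker_ext (C : Category) (hC : pointed C) (X Y : C) (f : Hom X Y)
    (K : Kernel hC f) (T : C) (u v : Hom T (ker K)) :
  ker_map K ∘ u = ker_map K ∘ v -> u = v.
Proof.
  intros e.
  assert (e' : f ∘ (ker_map K ∘ v) = zero_map hC T Y).
  { now rewrite comp_assoc, (proj1 (ker_is_kernel K)), zero_map_comp. }
  exact (exists_unique_eq (proj2 (ker_is_kernel K) T _ e') e eq_refl).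
Qed.

(* Regularity includes the existence of all finite limits. *)
Definition homological (C : Category) : Prop :=
  pointed C /\ regular C /\ protomodular C.

Lemma homological_pointed (C : Category) : homological C -> pointed C.
Proof. now intros [h _]. Qed.

Lemma homological_kernels (C : Category) (hC : homological C) :
  has_kernels (homological_pointed hC).
Proof. apply finite_limits_kernels. exact (proj1 (proj1 (proj2 hC))). Qed.

Definition is_coproduct (C : Category) (X Y S : C)
    (i1 : Hom X S) (i2 : Hom Y S) : Prop :=
  forall (T : C) (t1 : Hom X T) (t2 : Hom Y T),
    exists! u : Hom S T, u ∘ i1 = t1 /\ u ∘ i2 = t2.

Record Coproduct (C : Category) (X Y : C) : Type := {
  coprod : C;
  inj1 : Hom X coprod;
  inj2 : Hom Y coprod;
  coprod_is_coproduct : is_coproduct inj1 inj2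
}.

Definition has_binary_coproducts (C : Category) : Prop :=
  forall X Y : C, inhabited (Coproduct X Y).

Definition copair (C : Category) (X Y : C) (S : Coproduct X Y) (T : C)
    (t1 : Hom X T) (t2 : Hom Y T) : Hom (coprod S) T :=
  the (coprod_is_coproduct S t1 t2).

Lemma copair1 (C : Category) (X Y : C) (S : Coproduct X Y) (T : C)
    (t1 : Hom X T) (t2 : Hom Y T) : copair S t1 t2 ∘ inj1 S = t1.
Proof. exact (proj1 (the_spec (coprod_is_coproduct S t1 t2))). Qed.

Lemma copair2 (C : Category) (X Y : C) (S : Coproduct X Y) (T : C)
    (t1 : Hom X T) (t2 : Hom Y T) : copair S t1 t2 ∘ inj2 S = t2.
Proof. exact (proj2 (the_spec (coprod_is_coproduct S t1 t2))). Qed.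

Lemma coprod_ext (C : Category) (X Y : C) (S : Coproduct X Y) (T : C)
    (u v : Hom (coprod S) T) :
  u ∘ inj1 S = v ∘ inj1 S -> u ∘ inj2 S = v ∘ inj2 S -> u = v.
Proof.
  intros e1 e2.
  exact (exists_unique_eq (coprod_is_coproduct S _ _)
           (conj e1 e2) (conj eq_refl eq_refl)).
Qed.

Section Flat.
Context (C : Category) (hC : pointed C) (hK : has_kernels hC).
Context (hS : has_binary_coproducts C) (X : C).

Definition sum_with (Y : C) : Coproduct X Y := choose (hS X Y).

Definition sum_retraction (Y : C) : Hom (coprod (sum_with Y)) X :=
  copair (sum_with Y) (id X) (zero_map hC Y X).

Definition sum_map (Y Z : C) (g : Hom Y Z) :
    Hom (coprod (sum_with Y)) (coprod (sum_with Z)) :=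
  copair (sum_with Y) (inj1 (sum_with Z)) (inj2 (sum_with Z) ∘ g).

Definition flat_ker (Y : C) : Kernel hC (sum_retraction Y) :=
  choose (hK (sum_retraction Y)).

Lemma flat_map_eq (Y Z : C) (g : Hom Y Z) :
  sum_retraction Z ∘ (sum_map g ∘ ker_map (flat_ker Y)) =
  zero_map hC (ker (flat_ker Y)) X.
Proof.
  rewrite comp_assoc, <- (proj1 (ker_is_kernel (flat_ker Y))). f_equal.
  unfold sum_retraction, sum_map. apply coprod_ext.
  - now rewrite <- comp_assoc, !copair1.
  - now rewrite <- comp_assoc, !copair2, comp_assoc, copair2, zero_map_comp.
Qed.

Definition flat_map (Y Z : C) (g : Hom Y Z) :
    Hom (ker (flat_ker Y)) (ker (flat_ker Z)) :=
  ker_lift (flat_ker Z) (flat_map_eq g).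

Definition flat : Functor C C.
Proof.
  refine {| fobj := fun Y => ker (flat_ker Y); fmap := flat_map |}.
  - intros Y. apply ker_ext. unfold flat_map. rewrite ker_lift_eq, comp_id_r.
    transitivity (id (coprod (sum_with Y)) ∘ ker_map (flat_ker Y));
      [f_equal | apply comp_id_l].
    apply coprod_ext; unfold sum_map.
    + now rewrite copair1, comp_id_l.
    + now rewrite copair2, comp_id_l, comp_id_r.
  - intros Y Z W g f. apply ker_ext. unfold flat_map.
    rewrite ker_lift_eq, comp_assoc, ker_lift_eq, <- comp_assoc, ker_lift_eq.
    rewrite comp_assoc. f_equal.
    apply coprod_ext; unfold sum_map.
    + now rewrite <- comp_assoc, !copair1.
    + now rewrite <- comp_assoc, !copair2, !comp_assoc, copair2.
Defined.

End Flat.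

Arguments flat {C hC} hK hS X.

(* Main.v *)
Require Import Defs.
Local Open Scope cat_scope.
Set Implicit Arguments.
Unset Strict Implicit.
Unset Printing Implicit Defensive.

(** The kernel functor on points over [X] is, up to isomorphism, change of base
    along [O -> X] with [O] a zero object.  It sends the point
    [X + Y -> X] to [X♭Y], and the functor [Y |-> X + Y] into points preserves
    jointly strongly epimorphic pairs ([sum_point_map_jse]).  So if change of
    base is coherent then [X♭(-)] preserves such pairs ([flat_jse]).

    For the converse, preservation of finite limits holds anyway
    ([change_of_base_finite_limits]).  For jointly strongly epimorphic pairs it
    suffices to treat kernel functors: change of base leaves kernels alone
    ([base_kernel]), and by protomodularity kernels reflect jointly strongly
    epimorphic pairs ([kernel_reflects_jse]).

    The heart of the matter is [kernel_jse_of_flat].  Let [u : A -> Z] and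
    [v : B -> Z] be a jointly strongly epimorphic pair of points over [X], with
    restrictions [u'] and [v'] to the kernels, and let [M] be the subobject of
    [ker Z] generated by [ker A] and [ker B].  By protomodularity [X] and
    [ker A] cover [A], and likewise for [B], so [X + M -> Z] is a regular epi;
    pulling back along [ker Z -> Z], so is [X♭M -> ker Z].  On the other hand
    [X♭(ker A) -> ker Z] factors through the action [X♭(ker A) -> ker A], hence
    through [M], and the same holds for [B].  Since [X♭(ker A)] and
    [X♭(ker B)] are jointly strongly epimorphic in [X♭M] by hypothesis, all of
    [X♭M -> ker Z] factors through [M] (the subobject [M] is stable under the
    action of [X]), so [M] is the whole of [ker Z]. *)

(** * Isomorphisms and monomorphisms *)

Lemma mono_comp (C : Category) (X Y Z : C) (g : Hom Y Z) (f : Hom X Y) :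
  mono g -> mono f -> mono (g ∘ f).
Proof.
  intros hg hf T a b e. apply hf, hg. now rewrite !comp_assoc.
Qed.

Lemma iso_mono (C : Category) (X Y : C) (f : Hom X Y) : iso f -> mono f.
Proof.
  intros [g [e _]] T a b E.
  now rewrite <- (comp_id_l a), <- (comp_id_l b), <- e, <- !comp_assoc, E.
Qed.

Lemma mono_split_iso (C : Category) (X Y : C) (m : Hom X Y) (s : Hom Y X) :
  mono m -> m ∘ s = id Y -> iso m.
Proof.
  intros hm e. exists s. split; [|exact e].
  apply hm. now rewrite comp_assoc, e, comp_id_l, comp_id_r.
Qed.

Lemma iso_comp (C : Category) (X Y Z : C) (g : Hom Y Z) (f : Hom X Y) :
  iso g -> iso f -> iso (g ∘ f).
Proof.
  intros [g' [g1 g2]] [f' [f1 f2]]. exists (f' ∘ g'). split.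
  - now rewrite <- comp_assoc, (comp_assoc g' g f), g1, comp_id_l.
  - now rewrite <- comp_assoc, (comp_assoc f f' g'), f2, comp_id_l.
Qed.

Lemma iso_cancel_l (C : Category) (X Y Z : C) (g : Hom Y Z) (f : Hom X Y) :
  iso g -> iso (g ∘ f) -> iso f.
Proof.
  intros hg [h [h1 h2]]. exists (h ∘ g). split.
  - now rewrite <- comp_assoc.
  - apply (iso_mono hg). now rewrite !comp_assoc, h2, comp_id_l, comp_id_r.
Qed.

Lemma iso_cancel_r (C : Category) (X Y Z : C) (g : Hom Y Z) (f : Hom X Y) :
  iso f -> iso (g ∘ f) -> iso g.
Proof.
  intros [f' [f1 f2]] h.
  replace g with ((g ∘ f) ∘ f').
  - apply iso_comp; [exact h|]. now exists f.
  - now rewrite <- comp_assoc, f2, comp_id_r.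
Qed.

Lemma pb2_mono (C : Category) (X Y Z : C) (f : Hom X Z) (g : Hom Y Z)
    (P : Pullback f g) :
  mono f -> mono (pb2 P).
Proof.
  intros hf T a b e. apply pb_ext; [|exact e].
  apply hf. now rewrite !comp_assoc, (proj1 (pb_is_pullback P)), <- !comp_assoc, e.
Qed.

(** The pullback of [n] along [w] is a subobject of [Z] containing [f] and
    [g], so it is everything: factoring a map through a mono can be tested on a
    jointly strongly epimorphic pair. *)
Lemma jse_factor (C : Category) (hL : has_finite_limits C) (X Y Z N W : C)
    (f : Hom X Z) (g : Hom Y Z) (n : Hom N W) (w : Hom Z W) :
  jointly_strongly_epimorphic f g -> mono n ->
  (exists f', n ∘ f' = w ∘ f) -> (exists g', n ∘ g' = w ∘ g) ->
  exists w', n ∘ w' = w.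
Proof.
  intros hfg hn [f' ef] [g' eg].
  destruct (finite_limits_pullbacks hL n w) as [P].
  destruct (hfg _ (pb2 P)) as [d [_ d2]].
  - now apply pb2_mono.
  - exists (pb_lift P ef). apply pb_lift2.
  - exists (pb_lift P eg). apply pb_lift2.
  - exists (pb1 P ∘ d).
    now rewrite comp_assoc, (proj1 (pb_is_pullback P)), <- comp_assoc, d2, comp_id_r.
Qed.

(** * Images in a regular category *)

Lemma regular_epi_cancel (C : Category) (A Q T : C) (q : Hom A Q) (a b : Hom Q T) :
  regular_epi q -> a ∘ q = b ∘ q -> a = b.
Proof.
  intros [R [r1 [r2 [e h]]]] E.
  refine (exists_unique_eq (h T (b ∘ q) _) E eq_refl).
  now rewrite <- !comp_assoc, e.
Qed.

Lemma regular_epi_mono_iso (C : Category) (A Q M : C) (q : Hom A Q) (m : Hom M Q)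
    (h : Hom A M) :
  regular_epi q -> mono m -> m ∘ h = q -> iso m.
Proof.
  intros hq hm e. pose proof hq as [R [r1 [r2 [er hu]]]].
  destruct (hu M h) as [d [hd _]].
  { apply hm. now rewrite !comp_assoc, e. }
  apply (mono_split_iso (s := d) hm).
  apply (regular_epi_cancel hq). now rewrite <- comp_assoc, hd, comp_id_l.
Qed.

(** The image is the coequalizer of the kernel pair.  Its comparison map is
    monic because two maps [a], [b] into it lift to [A] after restriction along
    regular epis (pullbacks of [q]); if [m] identifies [a] and [b], these lifts
    form a pair in the kernel pair of [f], which [q] identifies. *)
Lemma image_factorization (C : Category) (hR : regular C) (A B : C) (f : Hom A B) :
  exists (Q : C) (q : Hom A Q) (m : Hom Q B), regular_epi q /\ mono m /\ m ∘ q = f.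
Proof.
  destruct hR as [hL [hQ hS]].
  destruct (finite_limits_pullbacks hL f f) as [K].
  destruct (hQ _ _ _ f _ _ (pb_is_pullback K)) as [Q [q hq]].
  destruct (proj2 hq B f (proj1 (pb_is_pullback K))) as [m [em _]].
  assert (rq : regular_epi q) by (exists (pb K), (pb1 K), (pb2 K); exact hq).
  exists Q, q, m. split; [exact rq|]. split; [|exact em].
  intros T a b E.
  destruct (finite_limits_pullbacks hL a q) as [P1].
  pose proof (hS _ _ _ _ _ _ _ _ (pb_is_pullback P1) rq) as r1.
  destruct (finite_limits_pullbacks hL (b ∘ pb1 P1) q) as [P2].
  pose proof (hS _ _ _ _ _ _ _ _ (pb_is_pullback P2) rq) as r2.
  apply (regular_epi_cancel r1), (regular_epi_cancel r2).
  pose proof (proj1 (pb_is_pullback P1)) as e1.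
  pose proof (proj1 (pb_is_pullback P2)) as e2.
  rewrite e2, e1.
  assert (ef : f ∘ (pb2 P1 ∘ pb1 P2) = f ∘ pb2 P2).
  { rewrite <- em, <- (comp_assoc m q (pb2 P2)), <- e2, !comp_assoc, <- E.
    now rewrite <- (comp_assoc m q), <- e1, !comp_assoc. }
  pose proof (proj1 hq) as ek.
  rewrite <- (comp_assoc q), <- (pb_lift1 K ef), comp_assoc, ek, <- comp_assoc.
  now rewrite pb_lift2.
Qed.

Lemma extremal_regular_epi (C : Category) (hR : regular C) (A B : C) (f : Hom A B) :
  (forall (N : C) (n : Hom N B) (w : Hom A N), mono n -> n ∘ w = f -> iso n) ->
  regular_epi f.
Proof.
  intros hf.
  destruct (image_factorization hR f) as [Q [q [m [[R [r1 [r2 [e hu]]]] [hm em]]]]].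
  destruct (hf _ m q hm em) as [m' [m1 m2]].
  exists R, r1, r2. rewrite <- em. split.
  { now rewrite <- !comp_assoc, e. }
  intros T t et. destruct (hu T t et) as [d [ed ud]].
  exists (d ∘ m'). split.
  - now rewrite comp_assoc, <- (comp_assoc d m' m), m1, comp_id_r.
  - intros v hv. rewrite comp_assoc in hv.
    now rewrite (ud _ hv), <- comp_assoc, m2, comp_id_r.
Qed.

Lemma copair_regular_jse (C : Category) (X Y Z : C) (S : Coproduct X Y)
    (f : Hom X Z) (g : Hom Y Z) :
  regular_epi (copair S f g) -> jointly_strongly_epimorphic f g.
Proof.
  intros hr M m hm [f' ef] [g' eg].
  apply (regular_epi_mono_iso (h := copair S f' g') hr hm).
  apply coprod_ext; rewrite <- comp_assoc.
  - now rewrite !copair1.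
  - now rewrite !copair2.
Qed.

(** * Points and their change of base *)

Lemma pt_iso (C : Category) (X : C) (A B : Pt X) (m : Hom A B) :
  iso (proj1_sig m) <-> iso m.
Proof.
  split.
  - intros [g [g1 g2]]. destruct (proj2_sig m) as [mp ms].
    unshelve eexists (exist _ g _).
    + cbn. split.
      * now rewrite <- mp, <- comp_assoc, g2, comp_id_r.
      * now rewrite <- ms, comp_assoc, g1, comp_id_l.
    + split; now apply PointHom_eq.
  - intros [g [g1 g2]]. exists (proj1_sig g). split.
    + exact (f_equal (@proj1_sig _ _) g1).
    + exact (f_equal (@proj1_sig _ _) g2).
Qed.

(** With binary coproducts, forgetting the section of a point over [X] has a
    left adjoint: [phi : T -> X] generates the point [X + T].  Testing against
    these points transfers universal properties from points to arbitrary maps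
    over [X]. *)
Section FreePoint.
Context (C : Category) (X T : C) (S : Coproduct X T) (phi : Hom T X).

Definition free_point : Point X := {|
  pt_ob := coprod S;
  pt_proj := copair S (id X) phi;
  pt_sect := inj1 S;
  pt_split := copair1 S (id X) phi
|}.

Definition free_point_map (B : Point X) (t : Hom T (pt_ob B))
  (e : pt_proj B ∘ t = phi) : PointHom free_point B.
Proof.
  exists (copair S (pt_sect B) t). split; [|apply copair1].
  apply coprod_ext; cbn; rewrite <- comp_assoc.
  - now rewrite !copair1, pt_split.
  - now rewrite !copair2.
Defined.

End FreePoint.

(** Maps [T -> A] with equal images in [B] lie over the same map to [X], hence
    correspond to parallel maps of points out of one free point. *)
Lemma pt_mono (C : Category) (hS : has_binary_coproducts C) (X : C) (A B : Pt X)
    (m : Hom A B) :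
  mono m <-> mono (proj1_sig m).
Proof.
  split.
  - intros hm T a b e. destruct (hS X T) as [S].
    assert (ea : pt_proj A ∘ a = pt_proj A ∘ b).
    { rewrite <- (proj1 (proj2_sig m)), <- !comp_assoc. now f_equal. }
    assert (E : free_point_map S ea = free_point_map S eq_refl).
    { apply hm, PointHom_eq. cbn. apply coprod_ext; rewrite <- !comp_assoc.
      - now rewrite !copair1.
      - now rewrite !copair2. }
    apply (f_equal (@proj1_sig _ _)) in E. cbn in E.
    now rewrite <- (copair2 S (pt_sect A) a), E, copair2.
  - intros hm T a b e. apply PointHom_eq, hm.
    exact (f_equal (@proj1_sig _ _) e).
Qed.

(** The forgetful functor from points over [Y] to objects over [Y] is a right
    adjoint, so a limit of points is a limit of objects over [Y]. *)
Lemma pt_limit_over (C : Category) (hS : has_binary_coproducts C) (Y : C)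
    (J : Category) (D : Functor J (Pt Y)) (c : Cone D) (hc : is_limit c)
    (T : C) (phi : Hom T Y) (h : forall j : J, Hom T (pt_ob (D j))) :
  (forall j, pt_proj (D j) ∘ h j = phi) ->
  (forall (i j : J) (a : Hom i j), proj1_sig (fmap D a) ∘ h i = h j) ->
  exists! t : Hom T (pt_ob (vertex c)),
    pt_proj (vertex c) ∘ t = phi /\ forall j, proj1_sig (leg c j) ∘ t = h j.
Proof.
  intros hp hn. destruct (hS Y T) as [S].
  unshelve epose (c' := Build_Cone (D := D) (vertex := free_point S phi : Pt Y)
    (leg := fun j => free_point_map S (hp j)) _).
  { intros i j a. apply PointHom_eq. cbn.
    apply coprod_ext; rewrite <- comp_assoc.
    - rewrite !copair1. exact (proj2 (proj2_sig (fmap D a))).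
    - rewrite !copair2. apply hn. }
  destruct (hc c') as [u [hu uu]].
  exists (proj1_sig u ∘ inj2 S). split; [split|].
  - rewrite comp_assoc, (proj1 (proj2_sig u)). apply copair2.
  - intros j. rewrite comp_assoc. transitivity (proj1_sig (leg c' j) ∘ inj2 S).
    + now rewrite <- hu.
    + apply copair2.
  - intros t [tp tj]. rewrite (uu (free_point_map S tp)); [apply copair2|].
    intros j. apply PointHom_eq. cbn. apply coprod_ext; rewrite <- comp_assoc.
    + rewrite !copair1. exact (proj2 (proj2_sig (leg c j))).
    + now rewrite !copair2.
Qed.

(** A map of points from [T] to [f^*A] is a map from [T] to [A] over [Y] whose
    restriction to [X] is the prescribed one; both the map and that condition
    are governed by [pt_limit_over]. *)
Lemma change_of_base_finite_limits (C : Category) (hS : has_binary_coproducts C)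
    (hP : has_pullbacks_of_split_epis C) (X Y : C) (f : Hom X Y) :
  preserves_finite_limits (change_of_base hP f).
Proof.
  intros J _ D c hc c'.
  pose (T := vertex c' : Point X).
  pose (l := fun j => proj1_sig (leg c' j) : Hom (pt_ob T) (pb (pt_pullback hP f (D j)))).
  assert (lp : forall j, pb1 _ ∘ l j = pt_proj T)
    by (intros j; exact (proj1 (proj2_sig (leg c' j)))).
  assert (ls : forall j, l j ∘ pt_sect T = pb_lift _ (base_sect_eq f (D j)))
    by (intros j; exact (proj2 (proj2_sig (leg c' j)))).
  assert (ln : forall (i j : J) (a : Hom i j), pb_lift _ (base_map_eq hP f (fmap D a)) ∘ l i = l j)
    by (intros i j a; exact (f_equal (@proj1_sig _ _) (leg_natural c' a))).
  destruct (pt_limit_over hS hc (T := pt_ob T) (phi := f ∘ pt_proj T)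
    (h := fun j => pb2 _ ∘ l j)) as [t [[tp tj] tu]].
  { intros j. rewrite comp_assoc, <- (proj1 (pb_is_pullback _)), <- comp_assoc.
    now rewrite lp. }
  { intros i j a. now rewrite <- (ln i j a), !comp_assoc, pb_lift2. }
  (* [t] respects the sections because maps into the limit from the base are unique. *)
  assert (ts : t ∘ pt_sect T = pt_sect (vertex c) ∘ f).
  { refine (exists_unique_eq (pt_limit_over hS hc (T := X) (phi := f)
      (h := fun j => pt_sect (D j) ∘ f) _ _) _ _).
    - intros j. now rewrite comp_assoc, pt_split, comp_id_l.
    - intros i j a. now rewrite comp_assoc, (proj2 (proj2_sig (fmap D a))).
    - split.
      + now rewrite comp_assoc, tp, <- comp_assoc, pt_split, comp_id_r.
      + intros j. now rewrite comp_assoc, tj, <- comp_assoc, ls, pb_lift2.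
    - split.
      + now rewrite comp_assoc, pt_split, comp_id_l.
      + intros j. now rewrite comp_assoc, (proj2 (proj2_sig (leg c j))). }
  unshelve eexists (exist _ (pb_lift (pt_pullback hP f (vertex c)) (eq_sym tp)) _).
  { split; cbn.
    - apply pb_lift1.
    - apply pb_ext; rewrite comp_assoc, ?pb_lift1, ?pb_lift2.
      + apply pt_split.
      + exact ts. }
  split.
  - intros j. apply PointHom_eq. cbn. apply pb_ext.
    + rewrite comp_assoc, !pb_lift1. symmetry. apply lp.
    + rewrite comp_assoc, pb_lift2, <- comp_assoc, pb_lift2. apply tj.
  - intros v hv. apply PointHom_eq. cbn. apply pb_ext.
    + rewrite pb_lift1. symmetry. exact (proj1 (proj2_sig v)).
    + rewrite pb_lift2. apply tu. split.
      * rewrite comp_assoc, <- (proj1 (pb_is_pullback _)), <- comp_assoc.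
        f_equal. exact (proj1 (proj2_sig v)).
      * intros j. unfold l. rewrite <- (hv j). cbn.
        now rewrite !comp_assoc, pb_lift2.
Qed.

(** * Kernels of points *)

Lemma comp_zero_map (C : Category) (hp : pointed C) (X Y Z : C) (f : Hom Y Z) :
  f ∘ zero_map hp X Y = zero_map hp X Z.
Proof.
  apply zero_map_unique; [|exact (the_spec (zero_map_exists hp X Z))].
  destruct (the_spec (zero_map_exists hp X Y)) as [O [hO [a [b e]]]].
  exists O. split; [exact hO|]. exists a, (f ∘ b).
  unfold zero_map. now rewrite e, comp_assoc.
Qed.

Lemma kernel_mono (C : Category) (hp : pointed C) (K A B : C) (f : Hom A B)
    (k : Hom K A) :
  is_kernel hp f k -> mono k.
Proof.
  intros hk T a b e. exact (ker_ext (K := Build_Kernel hk) e).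
Qed.

Lemma kernel_map_exists (C : Category) (hp : pointed C) (X : C) (A B : Point X)
    (u : PointHom A B) (KA KB : C) (kA : Hom KA (pt_ob A)) (kB : Hom KB (pt_ob B)) :
  is_kernel hp (pt_proj A) kA -> is_kernel hp (pt_proj B) kB ->
  exists u' : Hom KA KB, kB ∘ u' = proj1_sig u ∘ kA.
Proof.
  intros hA hB. destruct (proj2 hB _ (proj1_sig u ∘ kA)) as [u' [e _]].
  - now rewrite comp_assoc, (proj1 (proj2_sig u)), (proj1 hA).
  - now exists u'.
Qed.

(** Together with [base_kernel], this identifies change of base along a map
    from a zero object with the kernel functor. *)
Lemma kernel_to_zero_iso (C : Category) (hp : pointed C) (O K A : C) (f : Hom A O)
    (k : Hom K A) :
  is_zero_object O -> is_kernel hp f k -> iso k.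
Proof.
  intros hO hk. destruct (proj2 hk A (id A)) as [s [es _]].
  - exact (exists_unique_eq (proj2 (hO A)) I I).
  - exact (mono_split_iso (kernel_mono hk) es).
Qed.

(** Pulling back does not change the fibre over zero. *)
Lemma base_kernel (C : Category) (hp : pointed C)
    (hP : has_pullbacks_of_split_epis C) (X Y : C) (f : Hom X Y)
    (A : Point Y) (K : C) (k : Hom K (pt_ob A)) :
  is_kernel hp (pt_proj A) k ->
  exists k' : Hom K (pt_ob (base_ob hP f A)),
    is_kernel hp (pt_proj (base_ob hP f A)) k' /\ pb2 (pt_pullback hP f A) ∘ k' = k.
Proof.
  intros hk.
  assert (e : f ∘ zero_map hp K X = pt_proj A ∘ k)
    by now rewrite comp_zero_map, (proj1 hk).
  exists (pb_lift (pt_pullback hP f A) e). split; [|apply pb_lift2].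
  split; cbn.
  - apply pb_lift1.
  - intros T t et. destruct (proj2 hk T (pb2 _ ∘ t)) as [u [eu uu]].
    { rewrite comp_assoc, <- (proj1 (pb_is_pullback _)), <- comp_assoc, et.
      apply comp_zero_map. }
    exists u. split.
    + apply pb_ext; rewrite comp_assoc, ?pb_lift1, ?pb_lift2; [|exact eu].
      now rewrite zero_map_comp.
    + intros v <-. apply uu. now rewrite comp_assoc, pb_lift2.
Qed.

Lemma base_map_kernel (C : Category) (hp : pointed C)
    (hP : has_pullbacks_of_split_epis C) (X Y : C) (f : Hom X Y)
    (A B : Point Y) (u : PointHom A B) (KA KB : C)
    (kA : Hom KA (pt_ob (base_ob hP f A))) (kB : Hom KB (pt_ob (base_ob hP f B)))
    (u' : Hom KA KB) :
  pt_proj (base_ob hP f A) ∘ kA = zero_map hp KA X ->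
  pt_proj (base_ob hP f B) ∘ kB = zero_map hp KB X ->
  pb2 (pt_pullback hP f B) ∘ kB ∘ u' = proj1_sig u ∘ (pb2 (pt_pullback hP f A) ∘ kA) ->
  kB ∘ u' = proj1_sig (base_map hP f u) ∘ kA.
Proof.
  cbn. intros zA zB e. apply pb_ext.
  - rewrite !comp_assoc, zB, pb_lift1, zA. apply zero_map_comp.
  - now rewrite !comp_assoc, pb_lift2, e, comp_assoc.
Qed.

Lemma protomodular_kernel_iso (C : Category) (hp : pointed C) (hPM : protomodular C)
    (X : C) (A B : Point X) (u : PointHom A B) (KA KB : C)
    (kA : Hom KA (pt_ob A)) (kB : Hom KB (pt_ob B)) (u' : Hom KA KB) :
  is_kernel hp (pt_proj A) kA -> is_kernel hp (pt_proj B) kB ->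
  kB ∘ u' = proj1_sig u ∘ kA -> iso u' -> iso (proj1_sig u).
Proof.
  intros hA hB e hu. destruct hPM as [hP hr].
  pose proof hp as [O hO]. destruct (proj1 (hO X)) as [o _].
  apply pt_iso, (hr _ _ o), pt_iso.
  destruct (base_kernel hP o hA) as [kA' [hA' eA]].
  destruct (base_kernel hP o hB) as [kB' [hB' eB]].
  apply (iso_cancel_r (f := kA')).
  { exact (kernel_to_zero_iso hO hA'). }
  change (iso (proj1_sig (base_map hP o u) ∘ kA')).
  rewrite <- (base_map_kernel (u := u) (u' := u') (proj1 hA') (proj1 hB')).
  - apply iso_comp; [exact (kernel_to_zero_iso hO hB')|exact hu].
  - now rewrite eA, eB.
Qed.

(** A subobject [N] of [A] containing both the section and the kernel is again
    a point over [X], and it has the same kernel as [A]; protomodularity then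
    forces [N] to be [A]. *)
Lemma section_kernel_jse (C : Category) (hp : pointed C) (hPM : protomodular C)
    (X : C) (A : Point X) (K : C) (k : Hom K (pt_ob A)) :
  is_kernel hp (pt_proj A) k -> jointly_strongly_epimorphic (pt_sect A) k.
Proof.
  intros hk N n hn [s es] [l el].
  assert (e : pt_proj A ∘ n ∘ s = id X) by now rewrite <- comp_assoc, es, pt_split.
  pose (B := Build_Point e).
  assert (hl : is_kernel hp (pt_proj B) l).
  { split; cbn.
    - now rewrite <- comp_assoc, el, (proj1 hk).
    - intros T t et. rewrite <- comp_assoc in et.
      destruct (proj2 hk T _ et) as [v [ev uv]]. exists v. split.
      + apply hn. now rewrite comp_assoc, el.
      + intros w <-. apply uv. now rewrite comp_assoc, el. }
  pose (u := exist _ n (conj eq_refl es) : PointHom B A).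
  apply (protomodular_kernel_iso hPM (u := u) (u' := id K) hl hk).
  - cbn. now rewrite comp_id_r.
  - exists (id K). now rewrite comp_id_l.
Qed.

(** The kernel functor preserves monos and, by protomodularity, reflects
    isomorphisms. *)
Lemma kernel_reflects_jse (C : Category) (hp : pointed C) (hPM : protomodular C)
    (hL : has_finite_limits C) (hS : has_binary_coproducts C)
    (X : C) (A B Z : Pt X) (u : Hom A Z) (v : Hom B Z)
    (KA KB KZ : C) (kA : Hom KA (pt_ob A)) (kB : Hom KB (pt_ob B))
    (kZ : Hom KZ (pt_ob Z)) (u' : Hom KA KZ) (v' : Hom KB KZ) :
  is_kernel hp (pt_proj A) kA -> is_kernel hp (pt_proj B) kB ->
  is_kernel hp (pt_proj Z) kZ ->
  kZ ∘ u' = proj1_sig u ∘ kA -> kZ ∘ v' = proj1_sig v ∘ kB ->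
  jointly_strongly_epimorphic u' v' -> jointly_strongly_epimorphic u v.
Proof.
  intros hA hB hZ eu ev huv M m hm [a ea] [b eb].
  apply (pt_mono hS) in hm.
  destruct (finite_limits_kernels hp hL (pt_proj M)) as [[KM kM hM]].
  destruct (kernel_map_exists m hM hZ) as [m' em].
  destruct (kernel_map_exists a hA hM) as [a' ea'].
  destruct (kernel_map_exists b hB hM) as [b' eb'].
  apply pt_iso, (protomodular_kernel_iso hPM hM hZ em).
  pose proof (kernel_mono hZ) as mZ.
  apply huv.
  - intros T x y E. apply (kernel_mono hM), hm.
    now rewrite !comp_assoc, <- em, <- !comp_assoc, E.
  - exists a'. apply mZ.
    now rewrite comp_assoc, em, <- comp_assoc, ea', eu, <- ea, comp_assoc.
  - exists b'. apply mZ.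
    now rewrite comp_assoc, em, <- comp_assoc, eb', ev, <- eb, comp_assoc.
Qed.

(** Points over a zero object are just objects, and the pullback of a point
    along [O -> X] is its kernel; so the hypothesis is the conclusion up to
    isomorphism. *)
Lemma base_zero_jse_kernel (C : Category) (hp : pointed C)
    (hS : has_binary_coproducts C) (hP : has_pullbacks_of_split_epis C)
    (O X : C) (o : Hom O X) (A B Z : Pt X) (u : Hom A Z) (v : Hom B Z)
    (KA KB KZ : C) (kA : Hom KA (pt_ob A)) (kB : Hom KB (pt_ob B))
    (kZ : Hom KZ (pt_ob Z)) (u' : Hom KA KZ) (v' : Hom KB KZ) :
  is_zero_object O ->
  is_kernel hp (pt_proj A) kA -> is_kernel hp (pt_proj B) kB ->
  is_kernel hp (pt_proj Z) kZ ->
  kZ ∘ u' = proj1_sig u ∘ kA -> kZ ∘ v' = proj1_sig v ∘ kB ->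
  jointly_strongly_epimorphic (fmap (change_of_base hP o) u) (fmap (change_of_base hP o) v) ->
  jointly_strongly_epimorphic u' v'.
Proof.
  intros hO hA hB hZ eu ev huv M m hm [a ea] [b eb].
  destruct (base_kernel hP o hA) as [kA' [hA' eA]].
  destruct (base_kernel hP o hB) as [kB' [hB' eB]].
  destruct (base_kernel hP o hZ) as [kZ' [hZ' eZ]].
  pose proof (kernel_to_zero_iso hO hA') as [rA [_ iA]].
  pose proof (kernel_to_zero_iso hO hB') as [rB [_ iB]].
  pose proof (kernel_to_zero_iso hO hZ') as iZ.
  destruct (proj2 (hO M)) as [z _], (proj1 (hO M)) as [s _].
  assert (fromO : forall (T : C) (x y : Hom O T), x = y)
    by (intros T x y; exact (exists_unique_eq (proj1 (hO T)) I I)).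
  assert (toO : forall (T : C) (x y : Hom T O), x = y)
    by (intros T x y; exact (exists_unique_eq (proj2 (hO T)) I I)).
  pose (PM := Build_Point (toO O (z ∘ s) (id O)) : Pt O).
  (* Over a zero object every map of underlying objects is a map of points. *)
  pose (lift := fun (P Q : Pt O) (h : Hom (pt_ob P) (pt_ob Q)) =>
    exist _ h (conj (toO _ _ _) (fromO _ _ _)) : Hom P Q).
  (* The subobject [m] of [KZ] becomes a subobject of the point [o^*Z]. *)
  apply (iso_cancel_l iZ).
  apply (proj2 (pt_iso (lift PM (base_ob hP o Z) (kZ' ∘ m)))).
  apply huv.
  - apply (pt_mono hS). cbn. apply mono_comp; [|exact hm].
    exact (kernel_mono hZ').
  - exists (lift (base_ob hP o A) PM (a ∘ rA)). apply PointHom_eq.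
    cbn -[base_map]. rewrite comp_assoc, <- (comp_assoc kZ'), ea.
    rewrite (base_map_kernel (u := u) (u' := u') (proj1 hA') (proj1 hZ')).
    + rewrite <- comp_assoc. exact (eq_trans (f_equal (comp _) iA) (comp_id_r _)).
    + now rewrite eA, eZ.
  - exists (lift (base_ob hP o B) PM (b ∘ rB)). apply PointHom_eq.
    cbn -[base_map]. rewrite comp_assoc, <- (comp_assoc kZ'), eb.
    rewrite (base_map_kernel (u := v) (u' := v') (proj1 hB') (proj1 hZ')).
    + rewrite <- comp_assoc. exact (eq_trans (f_equal (comp _) iB) (comp_id_r _)).
    + now rewrite eB, eZ.
Qed.

(** * From coherence to the functors [flat] *)

Section SumPoints.
Context (C : Category) (hp : pointed C) (hS : has_binary_coproducts C) (X : C).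

Definition sum_point (Y : C) : Pt X := free_point (sum_with hS X Y) (zero_map hp Y X).

Definition sum_point_map (Y Z : C) (g : Hom Y Z) : Hom (sum_point Y) (sum_point Z).
Proof.
  refine (free_point_map (B := sum_point Z) (sum_with hS X Y)
    (t := inj2 (sum_with hS X Z) ∘ g) _).
  cbn. now rewrite comp_assoc, copair2, zero_map_comp.
Defined.

(** A subpoint [M] of [X + Z] through which both maps factor contains the
    injection of [Z], because its pullback to [Z] contains [f] and [g]; it
    contains the injection of [X], since it is a subpoint.  So it is split by
    a map out of the coproduct. *)
Lemma sum_point_map_jse (hL : has_finite_limits C) (Y Y' Z : C)
    (f : Hom Y Z) (g : Hom Y' Z) :
  jointly_strongly_epimorphic f g ->
  jointly_strongly_epimorphic (sum_point_map f) (sum_point_map g).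
Proof.
  intros hfg M m hm [f' ef] [g' eg].
  apply (pt_mono hS) in hm. apply pt_iso.
  destruct (jse_factor hL (w := inj2 (sum_with hS X Z)) hfg hm) as [z ez].
  - exists (proj1_sig f' ∘ inj2 (sum_with hS X Y)).
    rewrite comp_assoc, <- (copair2 (sum_with hS X Y) (inj1 _) (inj2 _ ∘ f)).
    exact (f_equal (fun h => proj1_sig h ∘ inj2 (sum_with hS X Y)) ef).
  - exists (proj1_sig g' ∘ inj2 (sum_with hS X Y')).
    rewrite comp_assoc, <- (copair2 (sum_with hS X Y') (inj1 _) (inj2 _ ∘ g)).
    exact (f_equal (fun h => proj1_sig h ∘ inj2 (sum_with hS X Y')) eg).
  - apply (mono_split_iso (s := copair (sum_with hS X Z) (pt_sect M) z) hm).
    apply coprod_ext; rewrite <- comp_assoc, comp_id_l.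
    + rewrite copair1. exact (proj2 (proj2_sig m)).
    + now rewrite copair2.
Qed.

Lemma flat_jse (hK : has_kernels hp) (hL : has_finite_limits C)
    (hP : has_pullbacks_of_split_epis C) (O : C) (o : Hom O X) :
  is_zero_object O -> preserves_jse_pairs (change_of_base hP o) ->
  preserves_jse_pairs (flat hK hS X).
Proof.
  intros hO ho Y Y' Z f g hfg.
  refine (base_zero_jse_kernel hS hO
    (ker_is_kernel (flat_ker hK hS X Y) : is_kernel hp (pt_proj (sum_point Y)) _)
    (ker_is_kernel (flat_ker hK hS X Y') : is_kernel hp (pt_proj (sum_point Y')) _)
    (ker_is_kernel (flat_ker hK hS X Z) : is_kernel hp (pt_proj (sum_point Z)) _)
    _ _ (ho _ _ _ _ _ (sum_point_map_jse hL hfg))); apply ker_lift_eq.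
Qed.

End SumPoints.

(** * From the functors [flat] to coherence *)

(** The converse of [kernel_reflects_jse]; the argument is the one outlined at
    the top.  A subobject [n] of [KZ] containing [u'] and [v'] is first cut down
    to the subobject [m] that they generate, since preservation by [flat] can
    only be applied to a pair that is jointly strongly epimorphic. *)
Lemma kernel_jse_of_flat (C : Category) (hp : pointed C) (hR : regular C)
    (hPM : protomodular C) (hS : has_binary_coproducts C) (hK : has_kernels hp)
    (X : C) (hF : preserves_jse_pairs (flat hK hS X))
    (A B Z : Pt X) (u : Hom A Z) (v : Hom B Z)
    (KA KB KZ : C) (kA : Hom KA (pt_ob A)) (kB : Hom KB (pt_ob B))
    (kZ : Hom KZ (pt_ob Z)) (u' : Hom KA KZ) (v' : Hom KB KZ) :
  is_kernel hp (pt_proj A) kA -> is_kernel hp (pt_proj B) kB ->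
  is_kernel hp (pt_proj Z) kZ ->
  kZ ∘ u' = proj1_sig u ∘ kA -> kZ ∘ v' = proj1_sig v ∘ kB ->
  jointly_strongly_epimorphic u v -> jointly_strongly_epimorphic u' v'.
Proof.
  intros hA hB hZ eu ev huv N n hn [a ea] [b eb].
  pose proof (proj1 hR) as hL.
  destruct (hS KA KB) as [S].
  destruct (image_factorization hR (copair S a b)) as [M [q [i [hq [hi ei]]]]].
  pose (m := n ∘ i). pose (a' := q ∘ inj1 S). pose (b' := q ∘ inj2 S).
  assert (hm : mono m) by now apply mono_comp.
  assert (ea' : m ∘ a' = u').
  { unfold m, a'. rewrite <- comp_assoc, (comp_assoc i), ei, copair1. exact ea. }
  assert (eb' : m ∘ b' = v').
  { unfold m, b'. rewrite <- comp_assoc, (comp_assoc i), ei, copair2. exact eb. }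
  assert (hab : jointly_strongly_epimorphic a' b').
  { apply (copair_regular_jse (S := S)).
    replace (copair S a' b') with q; [exact hq|].
    apply coprod_ext; now rewrite ?copair1, ?copair2. }
  enough (im : iso m).
  { destruct im as [m' [_ e]]. apply (mono_split_iso (s := i ∘ m') hn).
    now rewrite comp_assoc. }
  pose (SM := sum_with hS X M).
  pose (eps := copair SM (pt_sect Z) (kZ ∘ m)).
  assert (peps : pt_proj Z ∘ eps = sum_retraction hp hS X M).
  { apply coprod_ext; unfold eps, sum_retraction; rewrite <- comp_assoc.
    - now rewrite !copair1, pt_split.
    - now rewrite !copair2, comp_assoc, (proj1 hZ), zero_map_comp. }
  (* A subobject of [Z] containing the image of [eps] is a subpoint that
     contains the section and the kernel of [A] and of [B], hence both points. *)
  assert (heps : regular_epi eps).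
  { apply (extremal_regular_epi hR). intros P p w hP ep.
    assert (e : pt_proj Z ∘ p ∘ (w ∘ inj1 SM) = id X).
    { rewrite <- comp_assoc, (comp_assoc p), ep. unfold eps.
      now rewrite copair1, pt_split. }
    assert (es : p ∘ (w ∘ inj1 SM) = pt_sect Z)
      by (rewrite comp_assoc, ep; apply copair1).
    pose (PP := Build_Point e : Pt X).
    pose (pp := exist _ p (conj eq_refl es) : Hom PP Z).
    assert (factor : forall (W : Pt X) (t : Hom W Z) (KW : C) (kW : Hom KW (pt_ob W))
        (c : Hom KW M), is_kernel hp (pt_proj W) kW ->
        kZ ∘ (m ∘ c) = proj1_sig t ∘ kW -> exists t' : Hom W PP, comp pp t' = t).
    { intros W t KW kW c hW et.
      destruct (jse_factor hL (w := proj1_sig t) (section_kernel_jse hPM hW) hP)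
        as [t' et'].
      - exists (w ∘ inj1 SM). now rewrite es, (proj2 (proj2_sig t)).
      - exists (w ∘ (inj2 SM ∘ c)). rewrite <- et, !comp_assoc, ep. unfold eps.
        now rewrite copair2.
      - unshelve eexists (exist _ t' _); [split; cbn|].
        + rewrite <- comp_assoc, et'. exact (proj1 (proj2_sig t)).
        + apply hP. now rewrite comp_assoc, et', es, (proj2 (proj2_sig t)).
        + now apply PointHom_eq. }
    apply (proj2 (pt_iso pp)), huv.
    - now apply (pt_mono hS).
    - apply (factor A u KA kA a' hA). now rewrite ea'.
    - apply (factor B v KB kB b' hB). now rewrite eb'. }
  pose (kM := ker_map (flat_ker hK hS X M)).
  destruct (proj2 hZ _ (eps ∘ kM)) as [e [ee _]].
  { rewrite comp_assoc, peps. exact (proj1 (ker_is_kernel _)). }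
  (* [e] is the pullback of [eps] along [kZ]: a map into [X + M] over the
     kernel of [Z] is killed by the retraction onto [X]. *)
  assert (he : regular_epi e).
  { apply (proj2 (proj2 hR) _ _ _ _ kZ eps e kM); [|exact heps].
    split; [exact ee|]. intros T t1 t2 et.
    assert (er : sum_retraction hp hS X M ∘ t2 = zero_map hp T X).
    { now rewrite <- peps, <- comp_assoc, <- et, comp_assoc, (proj1 hZ), zero_map_comp. }
    exists (ker_lift (flat_ker hK hS X M) er). split; [split|].
    - apply (kernel_mono hZ). rewrite comp_assoc, ee, <- comp_assoc.
      unfold kM. now rewrite ker_lift_eq.
    - apply ker_lift_eq.
    - intros t [_ e2]. apply ker_ext. now rewrite ker_lift_eq. }
  (* The witness is [c] after the action [X♭KW -> KW] of [X] on the kernel [KW],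
     which is the restriction to kernels of [eW] from [X + KW] to [W]. *)
  assert (act : forall (W : Pt X) (t : Hom W Z) (KW : C) (kW : Hom KW (pt_ob W))
      (c : Hom KW M), is_kernel hp (pt_proj W) kW ->
      kZ ∘ (m ∘ c) = proj1_sig t ∘ kW ->
      exists x, m ∘ x = e ∘ fmap (flat hK hS X) c).
  { intros W t KW kW c hW et.
    pose (eW := copair (sum_with hS X KW) (pt_sect W) kW).
    destruct (proj2 hW _ (eW ∘ ker_map (flat_ker hK hS X KW))) as [x [ex _]].
    { rewrite <- (proj1 (ker_is_kernel (flat_ker hK hS X KW))), comp_assoc.
      f_equal. apply coprod_ext; unfold eW, sum_retraction; rewrite <- comp_assoc.
      - now rewrite !copair1, pt_split.
      - now rewrite !copair2, (proj1 hW). }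
    exists (c ∘ x). apply (kernel_mono hZ).
    transitivity (kZ ∘ (m ∘ c) ∘ x); [now rewrite !comp_assoc|].
    rewrite et, <- comp_assoc, ex.
    rewrite (comp_assoc kZ), ee, <- comp_assoc. cbn. unfold kM, flat_map.
    rewrite ker_lift_eq, !comp_assoc. f_equal.
    apply coprod_ext; unfold eW, eps, sum_map; rewrite <- !comp_assoc.
    - rewrite !copair1. exact (proj2 (proj2_sig t)).
    - now rewrite !copair2, (comp_assoc _ (inj2 _)), copair2, <- comp_assoc, et. }
  destruct (jse_factor hL (w := e) (hF _ _ _ _ _ hab) hm) as [d ed].
  - apply (act A u KA kA a' hA). now rewrite ea'.
  - apply (act B v KB kB b' hB). now rewrite eb'.
  - exact (regular_epi_mono_iso he hm ed).
Qed.

Theorem theorem3p18 (C : Category) (hC : homological C)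
    (hS : has_binary_coproducts C) :
  algebraically_coherent C <->
  forall X : C, preserves_jse_pairs (flat (homological_kernels hC) hS X).
Proof.
  pose proof hC as [[O hO] [hR hPM]].
  split.
  - intros [hL hcoh] X. destruct (proj1 (hO X)) as [o _].
    exact (flat_jse hL hO (proj2 (hcoh _ _ o))).
  - intros hF. exists (proj1 hR). intros X Y f. split.
    { apply (change_of_base_finite_limits hS). }
    intros A B Z u v huv.
    destruct (homological_kernels hC (pt_proj A)) as [[KA kA hA]].
    destruct (homological_kernels hC (pt_proj B)) as [[KB kB hB]].
    destruct (homological_kernels hC (pt_proj Z)) as [[KZ kZ hZ]].
    destruct (kernel_map_exists u hA hZ) as [u' eu].
    destruct (kernel_map_exists v hB hZ) as [v' ev].
    pose proof (kernel_jse_of_flat hR hPM (hF Y) hA hB hZ eu ev huv) as huv'.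
    pose (hP := finite_limits_split_pullbacks (proj1 hR)).
    destruct (base_kernel hP f hA) as [kA' [hA' eA]].
    destruct (base_kernel hP f hB) as [kB' [hB' eB]].
    destruct (base_kernel hP f hZ) as [kZ' [hZ' eZ]].
    refine (kernel_reflects_jse hPM (proj1 hR) hS hA' hB' hZ' _ _ huv').
    + apply (base_map_kernel (proj1 hA') (proj1 hZ')). now rewrite eZ, eA.
    + apply (base_map_kernel (proj1 hB') (proj1 hZ')). now rewrite eZ, eB.
Qed.
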